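(* Let $n\ge 0$ be an integer, let $\sigma$ be a real number, let $\beta\ge 0$ be a real number with $\beta\neq 1$, and let $0\le\gamma<1$. Then $$K_{n+1}^{\sigma}(\beta,\gamma)\subset K_n^{\sigma}(\beta,\gamma).$$
   Context: Let $E=\{z\in\mathbb{C}:|z|<1\}$ and let $A$ be the class of functions $f(z)=z+\sum_{k=2}^\infty a_kz^k$ analytic in $E$. For an integer $n\ge 0$ and real $\sigma$, define for $f\in A$ $$L_n^\sigma f(z)=z+\sum_{k=2}^\infty k^n\left(\frac{2}{k+1}\right)^{\sigma}a_kz^k .$$ Equivalently $L_n^\sigma f=D^n(I^\sigma f)=I^\sigma(D^nf)$, where $D^0f=f$, $D^nf(z)=z\,[D^{n-1}f(z)]'$ is the Salagean derivative, and $I^\sigma f(z)=z+\sum_{k\ge 2}\left(\frac{2}{k+1}\right)^\sigma a_kz^k$ is the Jung-Kim-Srivastava operator (for $\sigma>0$ it equals $\frac{2^\sigma}{z\Gamma(\sigma)}\int_0^z\left(\log\frac zt\right)^{\sigma-1}f(t)\,dt$). For a nonnegative real number $\delta\neq 1$, the notation ''$X\sim\delta$'' means $X>\delta$ if $0\le\delta<1$, and $X<\delta$ if $\delta>1$. The class $B_n^\sigma(\gamma)$ (for real $\gamma\ge 0$, $\gamma\ne 1$) consists of all $f\in A$ such that $\operatorname{Re}\dfrac{L_{n+1}^\sigma f(z)}{L_n^\sigma f(z)}\sim\gamma$ for all $z\in E$. The class $K_n^\sigma(\beta,\gamma)$ (for real $\beta\ge 0$, $\beta\neq 1$, and $0\le\gamma<1$)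 consists of all $f\in A$ for which there exists $g\in B_n^\sigma(\gamma)$ with $\operatorname{Re}\dfrac{L_{n+1}^\sigma f(z)}{L_n^\sigma g(z)}\sim\beta$ for all $z\in E$. In these conditions the quotients are understood as meromorphic functions on $E$ with removable singularities removed (so their value at $z=0$ is $1$), and the inequality is required at every point of $E$; in particular the quotient must have no poles in $E$. *)

(* Defs.v *)
(* Stdlib reals with Coquelicot's complex numbers. *)
From Stdlib Require Import Reals ClassicalEpsilon.
From Coquelicot Require Import Coquelicot.
Open Scope R_scope.

Definition E (z : C) : Prop := Cmod z < 1.

(* f(z) = z + a_2 z^2 + a_3 z^3 + ... on E. *)
Definition expansion (f : C -> C) (a : nat -> C) : Prop :=
  a 0%nat = RtoC 0 /\ a 1%nat = RtoC 1 /\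
  forall z : C, E z -> @is_pseries C_AbsRing C_NormedModule a z (f z).

(* Functions are total on C; only their values on E matter. *)
Definition class_A (f : C -> C) : Prop :=
  (forall z : C, E z -> @ex_derive C_AbsRing C_NormedModule f z) /\
  exists a : nat -> C, expansion f a.

(* Unique for f in class_A; unspecified otherwise. *)
Definition coef (f : C -> C) : nat -> C :=
  epsilon (inhabits (fun _ : nat => RtoC 0)) (expansion f).

(* For f in class_A the terms k = 0 and k = 1 of the series are 0 and z, since
   coef f 0 = 0, coef f 1 = 1 and the multiplier at k = 1 is 1^n * (2/2)^sigma.
   Rpower is the real power, its base being positive here. *)
Definition L_mult (n : nat) (sigma : R) (k : nat) : R :=
  INR k ^ n * Rpower (2 / (INR k + 1)) sigma.

Definition L (n : nat) (sigma : R) (f : C -> C) (z : C) : C :=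
  @iota C_CompleteNormedModule (fun w : C =>
    @is_pseries C_AbsRing C_NormedModule
      (fun k : nat => Cmult (RtoC (L_mult n sigma k)) (coef f k)) z w).

(* X ~ delta, for delta >= 0 and delta <> 1. *)
Definition sim (X delta : R) : Prop :=
  (0 <= delta < 1 /\ X > delta) \/ (delta > 1 /\ X < delta).

(* w is the value at z of the meromorphic function F/G once its removable
   singularities are removed, i.e. the limit at z over the punctured
   neighbourhoods of z; there is no such w when z is a pole. *)
Definition quotient_value (F G : C -> C) (z w : C) : Prop :=
  filterlim (fun x : C => Cdiv (F x) (G x))
    (@locally' C_UniformSpace z) (@locally C_UniformSpace w).

Definition Re_quotient_sim (F G : C -> C) (delta : R) : Prop :=
  forall z : C, E z -> exists w : C, quotient_value F G z w /\ sim (Re w) delta.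

Definition class_B (n : nat) (sigma gamma : R) (f : C -> C) : Prop :=
  class_A f /\ Re_quotient_sim (L (S n) sigma f) (L n sigma f) gamma.

Definition class_K (n : nat) (sigma beta gamma : R) (f : C -> C) : Prop :=
  class_A f /\
  exists g : C -> C, class_B n sigma gamma g /\
    Re_quotient_sim (L (S n) sigma f) (L n sigma g) beta.

(* Main.v *)
(* Write L_n f = z H_n with H_n analytic and H_n(0) = 1; the identity
   L_{n+1} f = z (L_n f)' becomes H_{n+1} = H_n + z H_n'.  Let H_n belong to g and K_n
   to f.  The same g witnesses membership in the larger class.

   For the inclusion B_{n+1}(gamma) in B_n(gamma), s = H_n / H_{n+1} is preferred to its
   inverse because it has no poles once H_{n+1} is known not to vanish.  It satisfies
   z s' = 1 - s P with P = H_{n+2} / H_{n+1}, and Re (1/s) > gamma means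
   Re s > gamma |s|^2.  If this fails, take a point z0 of smallest modulus where
   Re s = gamma |s|^2.  It minimises Re s - gamma |s|^2 on |z| <= |z0|, hence also the
   real part of (1 - 2 gamma conj(s(z0))) s, so that
   (1 - 2 gamma conj(s(z0))) z0 s'(z0) is real and <= 0; this forces Re P(z0) <= gamma.

   Likewise q = K_{n+1} / H_n satisfies q + z q' s = K_{n+2} / H_{n+1}, with Re s >= 0, and
   at a point z0 of smallest modulus where Re q = beta the number z0 q'(z0) is real and
   has the sign contradicting the hypothesis on K_{n+2} / H_{n+1}. *)

Require Import Defs.
From Stdlib Require Import Reals.
From Stdlib Require Import Lra Lia ClassicalEpsilon.
From Coquelicot Require Import Coquelicot.
Open Scope R_scope.

(** * Complex derivatives *)

Definition cderiv (f : C -> C) (z l : C) : Prop :=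
  forall eps : R, 0 < eps -> exists d : R, 0 < d /\ forall x : C,
    Cmod (x - z) < d -> Cmod (f x - f z - l * (x - z)) <= eps * Cmod (x - z).

Definition ccont (f : C -> C) (z : C) : Prop :=
  forall eps : R, 0 < eps -> exists d : R, 0 < d /\ forall x : C,
    Cmod (x - z) < d -> Cmod (f x - f z) < eps.

(** A fixed factor [K] in the error is absorbed by starting from [eps / (K + 1)]; the [+ 1] covers
    [K = 0]. *)
Lemma cderiv_intro (f : C -> C) (z l : C) (K : R) :
  0 <= K ->
  (forall eps : R, 0 < eps -> exists d : R, 0 < d /\ forall x : C,
    Cmod (x - z) < d ->
    Cmod (f x - f z - l * (x - z)) <= eps * K * Cmod (x - z)) ->
  cderiv f z l.
Proof.
  intros HK H eps Heps.
  destruct (H (eps / (K + 1))) as [d [Hd Hx]].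
  { apply Rdiv_lt_0_compat; lra. }
  exists d; split; [exact Hd|]. intros x Hxd.
  eapply Rle_trans; [apply Hx, Hxd|].
  apply Rmult_le_compat_r; [apply Cmod_ge_0|].
  apply (Rmult_le_reg_r (K + 1)); [lra|].
  replace (eps / (K + 1) * K * (K + 1)) with (eps * K) by (field; lra).
  nra.
Qed.

Lemma cderiv_ccont (f : C -> C) (z l : C) : cderiv f z l -> ccont f z.
Proof.
  intros H eps Heps.
  destruct (H 1 Rlt_0_1) as [d [Hd Hx]].
  pose proof (Cmod_ge_0 l) as Hl.
  assert (Hq : 0 < eps / (Cmod l + 1)) by (apply Rdiv_lt_0_compat; lra).
  exists (Rmin d (eps / (Cmod l + 1))).
  split; [apply Rmin_glb_lt; assumption|].
  intros x Hxd.
  assert (H1 := Hx x (Rlt_le_trans _ _ _ Hxd (Rmin_l _ _))).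
  assert (H2 := Rlt_le_trans _ _ _ Hxd (Rmin_r _ _)).
  replace (f x - f z)%C with ((f x - f z - l * (x - z)) + l * (x - z))%C by ring.
  eapply Rle_lt_trans; [apply Cmod_triangle|].
  rewrite Cmod_mult.
  apply Rle_lt_trans with ((Cmod l + 1) * Cmod (x - z)); [nra|].
  apply (Rmult_lt_compat_l (Cmod l + 1)) in H2; [|lra].
  replace ((Cmod l + 1) * (eps / (Cmod l + 1))) with eps in H2 by (field; lra).
  exact H2.
Qed.

Lemma cderiv_scal (a : C) (f : C -> C) (z l : C) :
  cderiv f z l -> cderiv (fun x => a * f x)%C z (a * l).
Proof.
  intros H. apply cderiv_intro with (Cmod a); [apply Cmod_ge_0|].
  intros eps Heps. destruct (H eps Heps) as [d [Hd Hx]].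
  exists d; split; [exact Hd|]. intros x Hxd.
  replace (a * f x - a * f z - a * l * (x - z))%C
    with (a * (f x - f z - l * (x - z)))%C by ring.
  rewrite Cmod_mult. specialize (Hx x Hxd).
  pose proof (Cmod_ge_0 a). nra.
Qed.

Lemma Cmod_le_plus_minus (a b : C) : Cmod a <= Cmod b + Cmod (b - a).
Proof.
  replace a with (b + - (b - a))%C at 1 by ring.
  rewrite <- (Cmod_opp (b - a)). apply Cmod_triangle.
Qed.

Lemma ccont_neq_0 (g : C -> C) (z : C) :
  ccont g z -> g z <> RtoC 0 ->
  exists d : R, 0 < d /\ forall x : C,
    Cmod (x - z) < d -> Cmod (g z) / 2 < Cmod (g x).
Proof.
  intros Hc Hz. apply Cmod_gt_0 in Hz.
  destruct (Hc (Cmod (g z) / 2)) as [d [Hd Hx]]; [lra|].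
  exists d; split; [exact Hd|]. intros x Hxd. specialize (Hx x Hxd).
  pose proof (Cmod_le_plus_minus (g z) (g x)). lra.
Qed.

(** The derivative is written as (f' - q g') / g with q = f / g because this form turns directly
    into the relations for z s' and z q' used below. *)
Lemma cderiv_div (f g : C -> C) (z l m : C) :
  cderiv f z l -> cderiv g z m -> g z <> RtoC 0 ->
  cderiv (fun x => f x / g x)%C z ((l - f z / g z * m) / g z).
Proof.
  intros Hf Hg Hz.
  assert (Hgc := cderiv_ccont _ _ _ Hg).
  destruct (ccont_neq_0 _ _ Hgc Hz) as [d0 [Hd0 Hx0]].
  assert (Hz' : 0 < Cmod (g z)) by (apply Cmod_gt_0; exact Hz).
  set (q := (f z / g z)%C). set (D := (l - q * m)%C).
  set (M := 2 / Cmod (g z)).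
  assert (HM : 0 < M) by (apply Rdiv_lt_0_compat; lra).
  assert (Hq := Cmod_ge_0 q). assert (HD := Cmod_ge_0 D).
  apply cderiv_intro with (M * (1 + Cmod q) + Cmod D * (M * M)).
  { assert (0 < M * (1 + Cmod q)) by (apply Rmult_lt_0_compat; lra).
    assert (0 <= Cmod D * (M * M)) by (apply Rmult_le_pos; nra). lra. }
  intros eps Heps.
  destruct (Hf eps Heps) as [d1 [Hd1 Hx1]].
  destruct (Hg eps Heps) as [d2 [Hd2 Hx2]].
  destruct (Hgc eps Heps) as [d3 [Hd3 Hx3]].
  exists (Rmin (Rmin d0 d1) (Rmin d2 d3)).
  split; [repeat apply Rmin_glb_lt; assumption|].
  intros x Hx.
  assert (Hxa := Rlt_le_trans _ _ _ Hx (Rmin_l _ _)).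
  assert (Hxb := Rlt_le_trans _ _ _ Hx (Rmin_r _ _)).
  specialize (Hx0 x (Rlt_le_trans _ _ _ Hxa (Rmin_l _ _))).
  specialize (Hx1 x (Rlt_le_trans _ _ _ Hxa (Rmin_r _ _))).
  specialize (Hx2 x (Rlt_le_trans _ _ _ Hxb (Rmin_l _ _))).
  specialize (Hx3 x (Rlt_le_trans _ _ _ Hxb (Rmin_r _ _))).
  assert (Hgx : g x <> RtoC 0) by (apply Cmod_gt_0; lra).
  assert (Hi : Cmod (/ g x) <= M).
  { rewrite Cmod_inv by exact Hgx. unfold M.
    replace (2 / Cmod (g z)) with (/ (Cmod (g z) / 2)) by (field; lra).
    apply Rinv_le_contravar; lra. }
  assert (Hiz : Cmod (/ g z) <= M).
  { rewrite Cmod_inv by exact Hz. unfold M, Rdiv.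
    assert (0 < / Cmod (g z)) by (apply Rinv_0_lt_compat; lra). lra. }
  set (h := (x - z)%C) in *.
  (* The first summand holds the linearisation errors of [f] and [g], the second the cost of
     replacing 1/g(z) by 1/g(x) in the linear term. *)
  replace (f x / g x - f z / g z - D / g z * h)%C with
    (/ g x * ((f x - f z - l * h) - q * (g x - g z - m * h))
     + (D * h) * (/ g x * (/ g z * - (g x - g z))))%C
    by (unfold D, q; field; split; assumption).
  eapply Rle_trans; [apply Cmod_triangle|].
  rewrite !Cmod_mult, Cmod_opp.
  assert (Hn : Cmod ((f x - f z - l * h) - q * (g x - g z - m * h))
               <= eps * (1 + Cmod q) * Cmod h).
  { unfold Cminus at 1. eapply Rle_trans; [apply Cmod_triangle|].
    rewrite Cmod_opp, Cmod_mult. nra. }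
  assert (Hh := Cmod_ge_0 h).
  assert (T1 : Cmod (/ g x) * Cmod ((f x - f z - l * h) - q * (g x - g z - m * h))
    <= M * (eps * (1 + Cmod q) * Cmod h))
    by (apply Rmult_le_compat; auto using Cmod_ge_0).
  assert (T2 : Cmod (/ g x) * (Cmod (/ g z) * Cmod (g x - g z)) <= M * (M * eps)).
  { apply Rmult_le_compat; auto using Cmod_ge_0.
    { apply Rmult_le_pos; apply Cmod_ge_0. }
    apply Rmult_le_compat; auto using Cmod_ge_0. lra. }
  assert (T3 : Cmod D * Cmod h * (Cmod (/ g x) * (Cmod (/ g z) * Cmod (g x - g z)))
    <= Cmod D * Cmod h * (M * (M * eps)))
    by (apply Rmult_le_compat_l; [apply Rmult_le_pos|]; assumption).
  lra.
Qed.

Lemma im_le_Cmod (c : C) : Rabs (Im c) <= Cmod c.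
Proof. exact (Rle_trans _ _ _ (Rmax_r _ _) (Rmax_Cmod c)). Qed.

(** * Minima of real parts on discs *)

(* Test the minimality of z0 at the points z0 (1 - t v), Re v > 0, t small. *)
Lemma boundary_min (q : C -> C) (z0 D : C) :
  cderiv q z0 D ->
  (forall z : C, Cmod z <= Cmod z0 -> Re (q z0) <= Re (q z)) ->
  Im (z0 * D)%C = 0 /\ Re (z0 * D)%C <= 0.
Proof.
  intros Hq Hmin.
  assert (Hv : forall v : C, 0 < Re v -> Re (z0 * D * v)%C <= 0).
  { intros v Hv. apply Rnot_lt_le. intros Hc.
    set (c := Re (z0 * D * v)%C) in *.
    assert (Hm := Cmod_ge_0 (z0 * v)%C). set (m := Cmod (z0 * v)%C) in *.
    (* With this tolerance the error at a point at distance t m from [z0] stays below t c, the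
       first-order decrease of Re q. *)
    destruct (Hq (c / (2 * (m + 1)))) as [d [Hd Hx]].
    { apply Rdiv_lt_0_compat; lra. }
    assert (Hv2 : 0 < Cmod v ^ 2).
    { apply pow_lt. apply Cmod_gt_0. intros ->. simpl in Hv. lra. }
    (* The first bound on t gives |1 - t v| <= 1, so the test point stays in the disc; the second
       puts it within [d] of [z0]. *)
    set (t := Rmin (2 * Re v / Cmod v ^ 2) (d / (2 * (m + 1)))).
    assert (Ht : 0 < t) by (apply Rmin_glb_lt; apply Rdiv_lt_0_compat; lra).
    assert (Ht1 : t * Cmod v ^ 2 <= 2 * Re v).
    { apply Rle_trans with (2 * Re v / Cmod v ^ 2 * Cmod v ^ 2).
      - apply Rmult_le_compat_r; [lra|apply Rmin_l].
      - right. field. intros E0. rewrite E0 in Hv2. simpl in Hv2. lra. }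
    assert (Ht2 : t * m < d).
    { apply Rle_lt_trans with (d / (2 * (m + 1)) * m).
      - apply Rmult_le_compat_r; [lra|apply Rmin_r].
      - apply (Rmult_lt_reg_r (2 * (m + 1))); [lra|].
        replace (d / (2 * (m + 1)) * m * (2 * (m + 1))) with (d * m)
          by (field; lra). nra. }
    set (x := (z0 * (1 - t * v))%C).
    assert (Hxz : (x - z0)%C = (- (t * (z0 * v)))%C) by (unfold x; ring).
    assert (Hxm : Cmod (x - z0) = t * m).
    { rewrite Hxz, Cmod_opp, Cmod_mult, Cmod_R, Rabs_pos_eq by lra. reflexivity. }
    assert (Hxle : Cmod x <= Cmod z0).
    { unfold x. rewrite Cmod_mult.
      rewrite <- (Rmult_1_r (Cmod z0)) at 2.
      apply Rmult_le_compat_l; [apply Cmod_ge_0|].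
      apply Rsqr_incr_0_var; [|lra]. rewrite !Rsqr_pow2, Cmod2_alt.
      rewrite Cmod2_alt in Ht1.
      destruct v as [a b]. simpl in *. nra. }
    specialize (Hmin x Hxle).
    specialize (Hx x). rewrite Hxm in Hx. specialize (Hx Ht2).
    assert (Hre := Rle_trans _ _ _ (re_le_Cmod _) Hx).
    apply Rabs_le_between in Hre. destruct Hre as [_ Hre].
    assert (Heq : Re (q x - q z0 - D * (x - z0))%C = Re (q x) - Re (q z0) + t * c).
    { rewrite Hxz. unfold c. destruct (q x), (q z0), D, z0, v. simpl. ring. }
    rewrite Heq in Hre.
    assert (c / (2 * (m + 1)) * (t * m) < t * c).
    { apply (Rmult_lt_reg_r (2 * (m + 1))); [lra|].
      replace (c / (2 * (m + 1)) * (t * m) * (2 * (m + 1))) with (t * c * m)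
          by (field; lra).
      assert (0 < t * c) by nra. nra. }
    lra. }
  set (w := (z0 * D)%C) in *. clearbody w. destruct w as [a b].
  assert (H1 := Hv (RtoC 1)). simpl in *.
  assert (Ha : a <= 0) by lra. split; [|exact Ha].
  destruct (Req_dec b 0) as [|Hb]; [assumption|exfalso].
  (* Testing v = e + i and v = e - i gives |b| <= -a e <= (1 - a) e = |b| / 2. *)
  set (e := Rabs b / (2 * (1 - a))).
  assert (Hbp := Rabs_pos_lt b Hb).
  assert (He : 0 < e) by (apply Rdiv_lt_0_compat; lra).
  assert (Hea : e * (2 * (1 - a)) = Rabs b) by (unfold e; field; lra).
  assert (H2 := Hv (e, 1) He). assert (H3 := Hv (e, -1) He). simpl in *.
  unfold Rabs in *. destruct (Rcase_abs b); nra.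
Qed.

(** The infimum of |z| over the points of E with [phi z <= 0] is attained, by compactness. Below
    that modulus [phi] is positive, and continuity along radii extends [0 <= phi] to the bounding
    circle. *)
Lemma first_zero (phi : C -> R) (z1 : C) :
  (forall z : C, E z -> forall eps : R, 0 < eps ->
    exists d : R, 0 < d /\ forall x : C,
      Cmod (x - z) < d -> Rabs (phi x - phi z) < eps) ->
  0 < phi (RtoC 0) -> E z1 -> phi z1 <= 0 ->
  exists z0 : C, E z0 /\ phi z0 = 0 /\
    forall z : C, Cmod z <= Cmod z0 -> 0 <= phi z.
Proof.
  intros Hc H0 Hz1 Hphi1. unfold E in *.
  (* Since [completeness] yields suprema, the infimum r0 is minus the supremum of -|z|. *)
  destruct (completeness (fun m => exists z, Cmod z < 1 /\ phi z <= 0 /\ m = - Cmod z))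
    as [m [Hub Hlub]].
  { exists 0. intros m [z [_ [_ ->]]]. pose proof (Cmod_ge_0 z). lra. }
  { exists (- Cmod z1), z1. auto. }
  set (r0 := - m).
  assert (Hlow : forall z, Cmod z < 1 -> phi z <= 0 -> r0 <= Cmod z).
  { intros z Hz Hp. assert (- Cmod z <= m) by (apply Hub; exists z; auto).
    unfold r0; lra. }
  assert (Happ : forall eta, 0 < eta ->
    exists z, Cmod z < 1 /\ phi z <= 0 /\ Cmod z < r0 + eta).
  { intros eta Heta. apply NNPP. intros Hn.
    assert (m <= m - eta); [|lra].
    apply Hlub. intros y [z [Hz [Hp ->]]]. apply Rnot_lt_le. intros Hlt.
    apply Hn. exists z. unfold r0. repeat split; [assumption..|lra]. }
  assert (Hr1 : r0 < 1) by (pose proof (Hlow z1 Hz1 Hphi1); lra).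
  (* If unattained, [phi] is positive on |z| <= r0, and a uniform [d] makes it positive at the
     points of E with |z| < r0 + d, against [Happ]. *)
  assert (Hex : exists z0, Cmod z0 <= r0 /\ phi z0 <= 0).
  { apply NNPP. intros Hn.
    assert (Hpos : forall z, Cmod z <= r0 -> 0 < phi z).
    { intros z Hz. apply Rnot_le_lt. intros Hp. apply Hn. exists z. auto. }
    (* The 2 converts closeness of both coordinates into closeness in modulus. Centres outside the
       closed disc get a [d] for which no point meets both bounds. *)
    assert (Hdel : forall u v : R, exists d : posreal, forall x : C,
      Cmod (x - (u, v)) < 2 * d -> Cmod x < r0 + d -> 0 < phi x).
    { intros u v. destruct (Rle_lt_dec (Cmod (u, v)) r0) as [Hle|Hlt].
      - assert (Hp := Hpos _ Hle).
        destruct (Hc (u, v)) with (eps := phi (u, v)) as [d [Hd Hx]];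
          [lra|assumption|].
        assert (Hd2 : 0 < d / 2) by lra.
        exists (mkposreal _ Hd2). simpl. intros x Hxd _.
        assert (Ha := Hx x). apply Rabs_lt_between in Ha; [|lra]. lra.
      - assert (Hd : 0 < (Cmod (u, v) - r0) / 4) by lra.
        exists (mkposreal _ Hd). simpl. intros x Hxd Hxr. exfalso.
        pose proof (Cmod_le_plus_minus (u, v) x). lra. }
    set (delta := fun u v => proj1_sig (constructive_indefinite_description _ (Hdel u v))).
    assert (Hdelta : forall u v x, Cmod (x - (u, v)) < 2 * delta u v ->
      Cmod x < r0 + delta u v -> 0 < phi x).
    { intros u v. unfold delta.
      destruct (constructive_indefinite_description _ (Hdel u v)) as [d Hd].
      exact Hd. }
    destruct (compactness_value_2d (-1) 1 (-1) 1 delta) as [d Hd].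
    destruct (Happ d (cond_pos d)) as [[x y] [Hz [Hp Hzd]]].
    assert (Hx1 := re_le_Cmod (x, y)). assert (Hy1 := im_le_Cmod (x, y)).
    simpl in Hx1, Hy1. apply Rabs_le_between in Hx1. apply Rabs_le_between in Hy1.
    apply (Hd x y); [lra|lra|].
    intros [u [v [_ [_ [Hu [Hv Hle]]]]]].
    assert (0 < phi (x, y)); [|lra].
    apply (Hdelta u v); [|lra].
    replace ((x, y) - (u, v))%C with (RtoC (x - u) + RtoC (y - v) * Ci)%C
      by (unfold Cminus, Cplus, Cmult, Copp, Ci, RtoC; simpl; f_equal; ring).
    eapply Rle_lt_trans; [apply Cmod_triangle|].
    rewrite Cmod_mult, Cmod_Ci, !Cmod_R. lra. }
  destruct Hex as [z0 [Hz0 Hp0]].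
  assert (Hz0r : Cmod z0 = r0).
  { apply Rle_antisym; [exact Hz0|apply Hlow; [lra|exact Hp0]]. }
  assert (Hnn : forall z : C, Cmod z <= Cmod z0 -> 0 <= phi z).
  { intros z Hz. apply Rnot_lt_le. intros Hneg.
    assert (Hzr : Cmod z = r0).
    { apply Rle_antisym; [lra|apply Hlow; lra]. }
    assert (Hzp : 0 < Cmod z).
    { apply Cmod_gt_0. intros ->. lra. }
    destruct (Hc z) with (eps := - phi z) as [d [Hd Hx]]; [lra|lra|].
    set (t := Rmin (/ 2) (d / 2)).
    assert (Ht : 0 < t) by (apply Rmin_glb_lt; lra).
    assert (Ht1 : t <= / 2) by apply Rmin_l.
    assert (Ht2 : t <= d / 2) by apply Rmin_r.
    specialize (Hx ((1 - t)%R * z)%C).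
    replace ((1 - t)%R * z - z)%C with (- (t * z))%C in Hx
      by (rewrite RtoC_minus; ring).
    rewrite Cmod_opp, Cmod_mult, Cmod_R, Rabs_pos_eq in Hx by lra.
    assert (Hx' := Hx ltac:(nra)). apply Rabs_lt_between in Hx'.
    assert (Hm : Cmod ((1 - t)%R * z)%C = (1 - t) * Cmod z)
      by (rewrite Cmod_mult, Cmod_R, Rabs_pos_eq by lra; reflexivity).
    assert (r0 <= Cmod ((1 - t)%R * z)%C) by (apply Hlow; [rewrite Hm; nra|lra]).
    rewrite Hm in H. nra. }
  exists z0. split; [lra|]. split; [|exact Hnn].
  apply Rle_antisym; [exact Hp0|]. apply Hnn. lra.
Qed.

(** * Values of quotients *)

Lemma locally'_ball (z : C) (P : C -> Prop) (d : R) :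
  0 < d -> (forall x : C, x <> z -> Cmod (x - z) < d -> P x) ->
  @locally' C_UniformSpace z P.
Proof.
  intros Hd HP.
  (* Balls of [C_UniformSpace] are squares; passing to the modulus costs a factor sqrt 2, which is
     less than 2. *)
  assert (Hd2 : 0 < d / 2) by lra.
  exists (mkposreal _ Hd2). intros x Hx Hne. apply HP; [exact Hne|].
  apply (C_NormedModule_mixin_compat2 z x (mkposreal _ Hd2)) in Hx.
  simpl in Hx. change (minus x z) with (x - z)%C in Hx.
  assert (Hs : sqrt 2 < 2).
  { rewrite <- (sqrt_square 2) at 2 by lra. apply sqrt_lt_1; lra. }
  nra.
Qed.

Lemma quotient_value_intro (F G Q : C -> C) (z : C) (d : R) :
  0 < d ->
  (forall x : C, x <> z -> Cmod (x - z) < d -> (F x / G x)%C = Q x) ->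
  ccont Q z -> quotient_value F G z (Q z).
Proof.
  intros Hd HQ Hc. apply filterlim_locally. intros eps.
  destruct (Hc eps (cond_pos eps)) as [d' [Hd' Hx]].
  apply locally'_ball with (Rmin d d'); [apply Rmin_glb_lt; assumption|].
  intros x Hne Hxd. rewrite HQ.
  - apply C_NormedModule_mixin_compat1. apply Hx.
    exact (Rlt_le_trans _ _ _ Hxd (Rmin_r _ _)).
  - exact Hne.
  - exact (Rlt_le_trans _ _ _ Hxd (Rmin_l _ _)).
Qed.

Lemma quotient_value_unique (F G : C -> C) (z w w' : C) :
  quotient_value F G z w -> quotient_value F G z w' -> w = w'.
Proof.
  intros H H'. transitivity (C_lim (fun x => F x / G x)%C z).
  - symmetry. apply is_C_lim_unique. exact H.
  - apply is_C_lim_unique. exact H'.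
Qed.

(** * Differential subordination *)

(* H' is not the derivative of H: the relation says z (z H)' = z H'. *)
Definition euler_step (H H' : C -> C) : Prop :=
  forall z : C, E z -> exists D : C, cderiv H z D /\ H' z = (H z + z * D)%C.

(** Restricting to the ray through [z0] and separating real and imaginary parts gives access to the
    real mean value theorem. *)
Lemma cderiv_segment (f : C -> C) (z0 : C) (t : R) (D : C) :
  cderiv f (t * z0) D ->
  is_derive (fun s : R => Re (f (s * z0)%C)) t (Re (z0 * D)%C) /\
  is_derive (fun s : R => Im (f (s * z0)%C)) t (Im (z0 * D)%C).
Proof.
  intros Hf.
  assert (Hm := Cmod_ge_0 z0).
  assert (Hlim : forall eps, 0 < eps -> exists d : posreal, forall h : R,
    h <> 0 -> Rabs h < d ->
    Cmod (f ((t + h)%R * z0) - f (t * z0) - h * (z0 * D))%C < eps * Rabs h).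
  { intros eps Heps.
    destruct (Hf (eps / (Cmod z0 + 1))) as [d [Hd Hx]].
    { apply Rdiv_lt_0_compat; lra. }
    assert (Hd' : 0 < d / (Cmod z0 + 1)) by (apply Rdiv_lt_0_compat; lra).
    exists (mkposreal _ Hd'). simpl. intros h Hh Hhd.
    specialize (Hx ((t + h)%R * z0)%C).
    replace ((t + h)%R * z0 - t * z0)%C with (h * z0)%C in Hx
      by (rewrite RtoC_plus; ring).
    rewrite Cmod_mult, Cmod_R in Hx.
    assert (Hp := Rabs_pos_lt h Hh).
    apply (Rmult_lt_compat_r (Cmod z0 + 1)) in Hhd; [|lra].
    replace (d / (Cmod z0 + 1) * (Cmod z0 + 1)) with d in Hhd by (field; lra).
    replace (D * (h * z0))%C with (h * (z0 * D))%C in Hx by ring.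
    eapply Rle_lt_trans; [apply Hx; nra|].
    apply (Rmult_lt_reg_r (Cmod z0 + 1)); [lra|].
    replace (eps / (Cmod z0 + 1) * (Rabs h * Cmod z0) * (Cmod z0 + 1))
      with (eps * (Rabs h * Cmod z0)) by (field; lra).
    assert (0 < eps * Rabs h) by (apply Rmult_lt_0_compat; assumption). nra. }
  split; apply is_derive_Reals; intros eps Heps;
    destruct (Hlim eps Heps) as [d Hd]; exists d; intros h Hh Hhd;
    specialize (Hd h Hh Hhd); apply (Rmult_lt_reg_r (Rabs h));
    try (apply Rabs_pos_lt; exact Hh); rewrite <- Rabs_mult;
    (eapply Rle_lt_trans; [|exact Hd]);
    [eapply Rle_trans; [|apply re_le_Cmod] | eapply Rle_trans; [|apply im_le_Cmod]];
    right; f_equal;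
    destruct (f ((t + h)%R * z0)%C), (f (t * z0)%C), z0, D; simpl; field; exact Hh.
Qed.

(* Along a radius, |z H1(z)|^2 is nondecreasing because its logarithmic derivative
   is 2 Re(H2/H1)/t; vanishing at one point would propagate back to the origin. *)
Lemma euler_step_neq_0 (H1 H2 : C -> C) :
  euler_step H1 H2 -> H1 (RtoC 0) <> RtoC 0 ->
  (forall z : C, E z -> H1 z <> RtoC 0 -> 0 <= Re (H2 z / H1 z)%C) ->
  forall z : C, E z -> H1 z <> RtoC 0.
Proof.
  intros Hst H0 Hre z0 Hz0 Hzero.
  assert (HE : forall t : R, 0 <= t <= 1 -> E (t * z0)%C).
  { intros t Ht. unfold E in *. rewrite Cmod_mult, Cmod_R, Rabs_pos_eq by lra.
    pose proof (Cmod_ge_0 z0). nra. }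
  set (u := fun t : R => Re (H1 (t * z0)%C)).
  set (v := fun t : R => Im (H1 (t * z0)%C)).
  (* This is |t H1(t z0)|^2; its derivative is [dN] because [euler_step] makes H2(t z0) the
     derivative of t H1(t z0). *)
  set (N := fun t : R => t * t * (u t * u t + v t * v t)).
  set (dN := fun t : R => 2 * t * Re (Cconj (H1 (t * z0)%C) * H2 (t * z0)%C)%C).
  assert (Hder : forall t : R, 0 <= t <= 1 -> is_derive N t (dN t)).
  { intros t Ht. destruct (Hst _ (HE t Ht)) as [D [HD HD2]].
    apply cderiv_segment in HD. destruct HD as [Hu Hv].
    fold u in Hu. fold v in Hv. unfold N.
    assert (Hsq : is_derive (fun s : R => s * s) t (2 * t))
      by (auto_derive; [exact I|ring]).
    assert (HS := is_derive_plus _ _ _ _ _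
      (is_derive_mult _ _ _ _ _ Hu Hu Rmult_comm)
      (is_derive_mult _ _ _ _ _ Hv Hv Rmult_comm)).
    assert (HN := is_derive_mult _ _ _ _ _ Hsq HS Rmult_comm).
    replace (dN t) with
      (plus (mult (2 * t) (plus (mult (u t) (u t)) (mult (v t) (v t))))
        (mult (t * t)
          (plus (plus (mult (Re (z0 * D)%C) (u t)) (mult (u t) (Re (z0 * D)%C)))
                (plus (mult (Im (z0 * D)%C) (v t)) (mult (v t) (Im (z0 * D)%C)))))).
    { exact HN. }
    unfold dN, u, v. rewrite HD2. change plus with Rplus. change mult with Rmult.
    destruct (H1 (t * z0)%C) as [a b], z0 as [x y], D as [p q]. simpl. ring. }
  assert (Hpos : forall t : R, 0 <= t <= 1 -> 0 <= dN t).
  { intros t Ht. unfold dN. apply Rmult_le_pos; [lra|].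
    (* At a zero of [H1] the hypothesis says nothing, but there [dN] vanishes. *)
    destruct (Req_dec (Cmod (H1 (t * z0)%C)) 0) as [Hz|Hz].
    - apply Cmod_eq_0 in Hz. rewrite Hz. simpl. right. ring.
    - assert (Hnz : H1 (t * z0)%C <> RtoC 0).
      { intros Hz'. apply Hz. rewrite Hz'. apply Cmod_0. }
      specialize (Hre _ (HE t Ht) Hnz).
      replace (Cconj (H1 (t * z0)) * H2 (t * z0))%C
        with ((Cmod (H1 (t * z0)%C) ^ 2)%R * (H2 (t * z0) / H1 (t * z0)))%C
        by (rewrite Cmod2_conj; field; exact Hnz).
      rewrite re_scal_l. apply Rmult_le_pos; [apply pow2_ge_0|exact Hre]. }
  (* [N] is nonnegative, nondecreasing and zero at 1, so it vanishes on (0, 1]; continuity at the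
     origin then contradicts [H0]. *)
  assert (Hz : forall t : R, 0 < t <= 1 -> H1 (t * z0)%C = RtoC 0).
  { intros t Ht.
    destruct (MVT_gen N t 1 dN) as [c [Hc Heq]].
    - intros x Hx. rewrite Rmin_left, Rmax_right in Hx by lra. apply Hder. lra.
    - intros x Hx. rewrite Rmin_left, Rmax_right in Hx by lra.
      apply derivable_continuous_pt. exists (dN x). apply is_derive_Reals, Hder. lra.
    - rewrite Rmin_left, Rmax_right in Hc by lra.
      assert (HN1 : N 1 = 0).
      { unfold N, u, v. rewrite Cmult_1_l, Hzero. simpl. ring. }
      assert (Hc0 := Hpos c ltac:(lra)).
      assert (HNt : N t <= 0) by nra.
      unfold N in HNt.
      assert (Huv : u t * u t + v t * v t <= 0).
      { apply Rnot_lt_le. intros Hlt.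
        assert (0 < t * t) by (apply Rmult_lt_0_compat; lra). nra. }
      unfold u, v in Huv. destruct (H1 (t * z0)%C) as [a b]. simpl in Huv.
      unfold RtoC. f_equal; nra. }
  destruct (Hst (RtoC 0)) as [D [HD _]].
  { unfold E. rewrite Cmod_0. lra. }
  destruct (ccont_neq_0 _ _ (cderiv_ccont _ _ _ HD) H0) as [d [Hd Hx]].
  assert (Hm := Cmod_ge_0 z0).
  set (t := Rmin (/ 2) (d / 2)).
  assert (Ht : 0 < t) by (apply Rmin_glb_lt; lra).
  assert (Ht1 : t <= / 2) by apply Rmin_l.
  assert (Ht2 : t <= d / 2) by apply Rmin_r.
  specialize (Hx (t * z0)%C).
  rewrite Hz, Cmod_0 in Hx by lra.
  replace (t * z0 - 0)%C with (t * z0)%C in Hx by ring.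
  rewrite Cmod_mult, Cmod_R, Rabs_pos_eq in Hx by lra.
  unfold E in Hz0. specialize (Hx ltac:(nra)).
  pose proof (Cmod_ge_0 (H1 (RtoC 0))). lra.
Qed.

Lemma ccont_Rabs_Re (q : C -> C) (z : C) : ccont q z ->
  forall eps : R, 0 < eps -> exists d : R, 0 < d /\ forall x : C,
    Cmod (x - z) < d -> Rabs (Re (q x) - Re (q z)) < eps.
Proof.
  intros Hc eps Heps. destruct (Hc eps Heps) as [d [Hd Hx]].
  exists d; split; [exact Hd|]. intros x Hxd.
  eapply Rle_lt_trans; [|apply Hx, Hxd].
  replace (Re (q x) - Re (q z)) with (Re (q x - q z)%C)
    by (destruct (q x), (q z); reflexivity).
  apply re_le_Cmod.
Qed.

(** Only lower bounds by an arbitrary real [b] are treated; the case beta > 1 is reduced to this one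
    by changing the sign of K. At a first contact point, Re (K2 / H1) = b + w Re (H0 / H1) with w =
    z0 q'(z0) <= 0. *)
Lemma ratio_half_plane (K1 K2 H0 H1 : C -> C) (b : R) :
  euler_step K1 K2 -> euler_step H0 H1 ->
  (forall z : C, E z -> H0 z <> RtoC 0) ->
  (forall z : C, E z -> H1 z <> RtoC 0) ->
  (forall z : C, E z -> 0 <= Re (H0 z / H1 z)%C) ->
  b < Re (K1 (RtoC 0) / H0 (RtoC 0))%C ->
  (forall z : C, E z -> b < Re (K2 z / H1 z)%C) ->
  forall z : C, E z -> b < Re (K1 z / H0 z)%C.
Proof.
  intros HK HH Hn0 Hn1 Hs Hb0 Hb z1 Hz1. apply Rnot_le_lt. intros Hle.
  set (q := fun z => (K1 z / H0 z)%C).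
  assert (Hq : forall z, E z -> exists k h : C,
    K2 z = (K1 z + z * k)%C /\ H1 z = (H0 z + z * h)%C /\
    cderiv q z ((k - q z * h) / H0 z)%C).
  { intros z Hz. destruct (HK z Hz) as [k [Hk Hk2]].
    destruct (HH z Hz) as [h [Hh Hh1]].
    exists k, h. repeat split; try assumption.
    apply cderiv_div; [assumption..|apply Hn0, Hz]. }
  destruct (first_zero (fun z => Re (q z) - b) z1) as [z0 [Hz0 [Heq Hmin]]].
  - intros z Hz eps Heps. destruct (Hq z Hz) as [k [h [_ [_ Hd]]]].
    destruct (ccont_Rabs_Re _ _ (cderiv_ccont _ _ _ Hd) eps Heps) as [d [Hdp Hx]].
    exists d; split; [exact Hdp|]. intros x Hxd.
    replace (Re (q x) - b - (Re (q z) - b)) with (Re (q x) - Re (q z)) by ring.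
    apply Hx, Hxd.
  - unfold q. lra.
  - exact Hz1.
  - unfold q. lra.
  - destruct (Hq z0 Hz0) as [k [h [Hk2 [Hh1 Hd]]]].
    apply boundary_min in Hd.
    2:{ intros z Hz. specialize (Hmin z Hz). cbv beta in Hmin, Heq. lra. }
    specialize (Hb z0 Hz0). specialize (Hs z0 Hz0).
    specialize (Hn0 z0 Hz0). specialize (Hn1 z0 Hz0).
    set (w := (z0 * ((k - q z0 * h) / H0 z0))%C) in *.
    (* The derivatives [k] and [h] are eliminated through z0 k = K2 - K1 and z0 h = H1 - H0. *)
    assert (Hkey : (K2 z0 / H1 z0)%C = (q z0 + w * (H0 z0 / H1 z0))%C).
    { replace w with (((K2 z0 - K1 z0) - q z0 * (H1 z0 - H0 z0)) / H0 z0)%C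
        by (unfold w; rewrite Hk2, Hh1; field; exact Hn0).
      unfold q. field. split; assumption. }
    rewrite Hkey, re_plus, re_mult in Hb. destruct Hd as [Hi Hr].
    rewrite Hi in Hb. nra.
Qed.

(** The conclusion is Re (H1 / H0) > gamma with the denominator cleared; it makes sense before [H0]
    is known to have no zeros, and its strictness then excludes them. *)
Lemma ratio_disc (H0 H1 H2 : C -> C) (gamma : R) :
  0 <= gamma < 1 ->
  euler_step H0 H1 -> euler_step H1 H2 -> H0 (RtoC 0) = RtoC 1 ->
  (forall z : C, E z -> H1 z <> RtoC 0) ->
  (forall z : C, E z -> gamma < Re (H2 z / H1 z)%C) ->
  forall z : C, E z ->
    gamma * Cmod (H0 z / H1 z) ^ 2 < Re (H0 z / H1 z)%C.
Proof.
  intros Hg HS0 HS1 H00 Hn1 HP z1 Hz1. apply Rnot_le_lt. intros Hle.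
  set (s := fun z => (H0 z / H1 z)%C).
  assert (Hs : forall z, E z -> exists h k : C,
    H1 z = (H0 z + z * h)%C /\ H2 z = (H1 z + z * k)%C /\
    cderiv s z ((h - s z * k) / H1 z)%C).
  { intros z Hz. destruct (HS0 z Hz) as [h [Hh Hh1]].
    destruct (HS1 z Hz) as [k [Hk Hk2]].
    exists h, k. repeat split; try assumption.
    apply cderiv_div; [assumption..|apply Hn1, Hz]. }
  destruct (first_zero (fun z => Re (s z) - gamma * Cmod (s z) ^ 2) z1)
    as [z0 [Hz0 [Heq Hmin]]].
  - intros z Hz eps Heps. destruct (Hs z Hz) as [h [k [_ [_ Hd]]]].
    apply cderiv_ccont in Hd.
    assert (Hm := Cmod_ge_0 (s z)).
    (* For |s(x) - s(z)| < e <= 1 the squared moduli differ by at most e (2 |s(z)| + 1) and the real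
       parts by less than e; [gamma < 1] then bounds the total by [eps]. *)
    set (e := Rmin 1 (eps / (2 * Cmod (s z) + 2))).
    assert (He : 0 < e) by (apply Rmin_glb_lt; [lra|apply Rdiv_lt_0_compat; lra]).
    assert (He1 : e <= 1) by apply Rmin_l.
    assert (He2 : e * (2 * Cmod (s z) + 2) <= eps).
    { apply Rle_trans with (eps / (2 * Cmod (s z) + 2) * (2 * Cmod (s z) + 2)).
      - apply Rmult_le_compat_r; [lra|apply Rmin_r].
      - right. field. lra. }
    destruct (Hd e He) as [d [Hdp Hx]].
    exists d; split; [exact Hdp|]. intros x Hxd. specialize (Hx x Hxd).
    assert (Hre := Rle_lt_trans _ _ _ (re_le_Cmod _) Hx).
    assert (Ha := Cmod_le_plus_minus (s z) (s x)).
    assert (Hb := Cmod_le_plus_minus (s x) (s z)).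
    replace (s z - s x)%C with (- (s x - s z))%C in Hb by ring.
    rewrite Cmod_opp in Hb.
    replace (Re (s x - s z)%C) with (Re (s x) - Re (s z)) in Hre
      by (destruct (s x), (s z); reflexivity).
    assert (Hmx := Cmod_ge_0 (s x)).
    set (A := Cmod (s x)) in *. set (B := Cmod (s z)) in *.
    apply Rabs_lt_between in Hre.
    assert (Hsq : - (e * (2 * B + 1)) <= A ^ 2 - B ^ 2 <= e * (2 * B + 1)).
    { split; nra. }
    apply Rabs_lt_between. split; nra.
  - unfold s. destruct (HS0 (RtoC 0)) as [D [_ HD]].
    { unfold E. rewrite Cmod_0. lra. }
    rewrite HD, H00.
    replace (1 / (1 + 0 * D))%C with (RtoC 1)
      by (field; replace (1 + 0 * D)%C with (RtoC 1) by ring; apply C1_nz).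
    rewrite Cmod_1. simpl. lra.
  - exact Hz1.
  - unfold s. lra.
  - destruct (Hs z0 Hz0) as [h [k [Hh1 [Hk2 Hd]]]].
    set (a := (1 - 2 * gamma * Cconj (s z0))%C).
    (* |s|^2 is convex, so replacing it by its tangent at z0 preserves the minimum
       and leaves the real part of an analytic function. *)
    apply (cderiv_scal a) in Hd. apply boundary_min in Hd.
    2:{ intros z Hz. specialize (Hmin z Hz). cbv beta in Hmin, Heq.
        rewrite Cmod2_alt in Hmin, Heq. unfold a.
        destruct (s z) as [x y], (s z0) as [x0 y0]. simpl in Hmin, Heq |- *.
        assert (0 <= gamma * ((x - x0) ^ 2 + (y - y0) ^ 2)).
        { apply Rmult_le_pos; [exact (proj1 Hg)|]. apply Rplus_le_le_0_compat; apply pow2_ge_0. }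
        lra. }
    specialize (HP z0 Hz0). specialize (Hn1 z0 Hz0).
    set (P := (H2 z0 / H1 z0)%C) in *.
    assert (Hw : (z0 * (a * ((h - s z0 * k) / H1 z0)))%C = ((1 - s z0 * P) * a)%C).
    { replace (z0 * (a * ((h - s z0 * k) / H1 z0)))%C
        with ((((H1 z0 - H0 z0) - s z0 * (H2 z0 - H1 z0)) / H1 z0) * a)%C
        by (rewrite Hk2, Hh1 at 1; rewrite Hh1; field; rewrite <- Hh1; exact Hn1).
      unfold s, P. field. exact Hn1. }
    rewrite Hw in Hd. destruct Hd as [Hi Hr].
    rewrite Cmod2_alt in Heq. unfold a in *. clear Hw.
    destruct (s z0) as [x y], P as [p r]. cbv beta in Heq. simpl in HP, Heq, Hi, Hr.
    (* In coordinates s = x + i y, u = u1 + i u2 = 1 - s P, a = a1 + i a2, n = |s|^2, and u a = -K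
       with K >= 0. As x = gamma n, |a| = 1, so u = -K conj(a); multiplying s P = 1 - u by conj(s)
       yields n p = gamma n (1 - K). *)
    set (n := x * x + y * y).
    set (u1 := 1 - (x * p - y * r)). set (u2 := - (x * r + y * p)).
    set (a1 := 1 - 2 * gamma * x). set (a2 := 2 * gamma * y).
    assert (Hi' : u1 * a2 + u2 * a1 = 0)
      by (rewrite <- Hi; unfold u1, u2, a1, a2; ring).
    assert (Hr' : u1 * a1 - u2 * a2 <= 0)
      by (eapply Rle_trans; [right|exact Hr]; unfold u1, u2, a1, a2; ring).
    set (K := - (u1 * a1 - u2 * a2)) in *.
    assert (Hx : x = gamma * n) by (unfold n; lra).
    assert (Ha : a1 * a1 + a2 * a2 = 1).
    { transitivity (1 - 4 * gamma * (x - gamma * n));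
        [unfold a1, a2, n; ring|rewrite <- Hx; ring]. }
    assert (Hu1 : u1 = - K * a1).
    { transitivity (u1 * (a1 * a1 + a2 * a2)); [rewrite Ha; ring|].
      transitivity (- K * a1 + a2 * (u1 * a2 + u2 * a1));
        [unfold K; ring|rewrite Hi'; ring]. }
    assert (Hu2 : u2 = K * a2).
    { transitivity (u2 * (a1 * a1 + a2 * a2)); [rewrite Ha; ring|].
      transitivity (K * a2 + a1 * (u1 * a2 + u2 * a1));
        [unfold K; ring|rewrite Hi'; ring]. }
    assert (Hnp : n * p = gamma * n * (1 - K)).
    { transitivity (x * (1 - u1) - y * u2); [unfold n, u1, u2; ring|].
      rewrite Hu1, Hu2.
      transitivity (x + K * (x - 2 * gamma * n)); [unfold a1, a2, n; ring|].
      rewrite Hx at 1. rewrite Hx at 1. ring. }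
    assert (HK : 0 <= K) by (unfold K; lra).
    assert (Hn : 0 <= n) by (unfold n; nra).
    assert (0 <= gamma * n * K) by (apply Rmult_le_pos; [nra|exact HK]).
    (* [gamma < p] leaves only s(z0) = 0, where [Hr] reads 1 <= 0. *)
    assert (Hn0 : n = 0) by nra.
    assert (Hx0 : x = 0) by (rewrite Hx, Hn0; ring).
    assert (Hy0 : y = 0) by (unfold n in Hn0; nra).
    clear - Hr Hx0 Hy0. subst. lra.
Qed.

(** * Complex power series on the unit disc *)

(* By Abel's lemma: the radius of convergence is at least 1. *)
Definition disc_bounded (c : nat -> C) : Prop :=
  forall r : R, 0 <= r < 1 -> exists M : R, forall k : nat, Cmod (c k) * r ^ k <= M.

(** Bernoulli's inequality [poly], 1 + k x <= (1 + x)^k, lets the linear factor be paid for by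
    enlarging r to r (1 + x), still below 1. *)
Lemma succ_mul_pow_le (r : R) : 0 <= r < 1 ->
  exists (B r' : R), 0 <= B /\ 0 <= r' < 1 /\
    forall k : nat, (INR k + 1) * r ^ k <= B * r' ^ k.
Proof.
  intros Hr. set (x := (1 - r) / 2).
  assert (Hx : 0 < x) by (unfold x; lra).
  exists (1 + / x), (r * (1 + x)).
  assert (Hix : 0 < / x) by (apply Rinv_0_lt_compat, Hx).
  split; [lra|]. split; [unfold x; nra|].
  intros k. rewrite Rpow_mult_distr.
  assert (Hk := poly k x Hx). assert (Hk0 := pos_INR k).
  assert (Hrk : 0 <= r ^ k) by (apply pow_le; lra).
  assert (INR k + 1 <= (1 + / x) * (1 + INR k * x)).
  { replace ((1 + / x) * (1 + INR k * x)) with (1 + INR k * x + / x + INR k)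
      by (field; lra). nra. }
  apply Rle_trans with ((1 + / x) * (1 + INR k * x) * r ^ k); [nra|].
  rewrite Rmult_assoc. apply Rmult_le_compat_l; [lra|].
  rewrite Rmult_comm. apply Rmult_le_compat_l; assumption.
Qed.

Lemma disc_bounded_succ_mul (c : nat -> C) :
  disc_bounded c -> disc_bounded (fun k => (INR k + 1)%R * c k)%C.
Proof.
  intros Hc r Hr. destruct (succ_mul_pow_le r Hr) as [B [r' [HB [Hr' Hk]]]].
  destruct (Hc r' Hr') as [M HM]. exists (B * M). intros k.
  assert (Hk0 := pos_INR k).
  rewrite Cmod_mult, Cmod_R, Rabs_pos_eq by lra.
  apply Rle_trans with (B * (Cmod (c k) * r' ^ k)).
  - specialize (Hk k). pose proof (Cmod_ge_0 (c k)). nra.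
  - apply Rmult_le_compat_l; [exact HB|apply HM].
Qed.

Lemma disc_bounded_pow_mul (c : nat -> C) (N : nat) :
  disc_bounded c -> disc_bounded (fun k => ((INR k + 1) ^ N)%R * c k)%C.
Proof.
  intros Hc. induction N as [|N IH].
  - intros r Hr. destruct (Hc r Hr) as [M HM]. exists M. intros k.
    simpl pow at 1. rewrite Cmult_1_l. apply HM.
  - apply disc_bounded_succ_mul in IH. intros r Hr.
    destruct (IH r Hr) as [M HM]. exists M. intros k. specialize (HM k).
    rewrite Cmult_assoc, <- RtoC_mult in HM. exact HM.
Qed.

Lemma disc_bounded_le (c c' : nat -> C) (B : R) :
  0 <= B -> (forall k, Cmod (c' k) <= B * Cmod (c k)) ->
  disc_bounded c -> disc_bounded c'.
Proof.
  intros HB Hle Hc r Hr. destruct (Hc r Hr) as [M HM]. exists (B * M).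
  intros k. specialize (HM k). specialize (Hle k).
  assert (0 <= r ^ k) by (apply pow_le; lra).
  apply Rle_trans with (B * Cmod (c k) * r ^ k); nra.
Qed.

Lemma disc_bounded_ex_series (c : nat -> C) (r : R) :
  disc_bounded c -> 0 <= r < 1 -> ex_series (fun k => Cmod (c k) * r ^ k).
Proof.
  intros Hc Hr. set (r' := (1 + r) / 2).
  assert (Hr' : 0 < r' < 1) by (unfold r'; lra).
  destruct (Hc r' ltac:(lra)) as [M HM].
  assert (Hq : 0 <= r / r' < 1).
  { split; [apply Rle_div_r; lra|]. apply Rlt_div_l; [lra|unfold r'; lra]. }
  apply (@ex_series_le R_AbsRing R_CompleteNormedModule)
    with (b := fun k => M * (r / r') ^ k).
  - intros k. change (Rabs (Cmod (c k) * r ^ k) <= M * (r / r') ^ k).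
    assert (Hqk : 0 <= (r / r') ^ k) by (apply pow_le; lra).
    assert (Hrk : r ^ k = r' ^ k * (r / r') ^ k).
    { rewrite <- Rpow_mult_distr. f_equal. field. lra. }
    rewrite Rabs_pos_eq.
    + rewrite Hrk. specialize (HM k). nra.
    + apply Rmult_le_pos; [apply Cmod_ge_0|apply pow_le; lra].
  - apply (@ex_series_scal R_AbsRing R_NormedModule M (fun k => (r / r') ^ k)).
    apply ex_series_geom.
    rewrite Rabs_pos_eq; lra.
Qed.

Lemma is_pseries_Cpow (c : nat -> C) (z l : C) :
  @is_pseries C_AbsRing C_NormedModule c z l <->
  @is_series C_AbsRing C_NormedModule (fun k => c k * z ^ k)%C l.
Proof.
  split; apply is_series_ext; intros k; [|symmetry];
    exact (Cmult_comm (z ^ k) (c k)).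
Qed.

Lemma is_series_Cmod_le (u : nat -> C) (b : nat -> R) (l : C) (B : R) :
  @is_series C_AbsRing C_NormedModule u l -> is_series b B ->
  (forall k, Cmod (u k) <= b k) -> Cmod l <= B.
Proof.
  intros Hu Hb Hle.
  assert (Hn : filterlim (fun n => Cmod (@sum_n C_NormedModule u n)) eventually
                 (locally (Cmod l))).
  { eapply filterlim_comp; [exact Hu|]. exact (@filterlim_norm C_AbsRing C_NormedModule l). }
  assert (H := filterlim_le (F := eventually)
    (fun n => Cmod (@sum_n C_NormedModule u n)) (sum_n b) (Cmod l) B).
  apply H; [|exact Hn|exact Hb].
  exists 0%nat. intros n _. induction n as [|n IH].
  - rewrite !sum_O. apply Hle.
  - rewrite !sum_Sn. eapply Rle_trans; [apply Cmod_triangle|].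
    apply Rplus_le_compat; [exact IH|apply Hle].
Qed.

Lemma ex_pseries_disc (c : nat -> C) (z : C) :
  disc_bounded c -> E z -> exists l, @is_pseries C_AbsRing C_NormedModule c z l.
Proof.
  intros Hc Hz. unfold E in Hz.
  destruct (@ex_series_le C_AbsRing C_CompleteNormedModule
    (fun k => c k * z ^ k)%C (fun k => Cmod (c k) * Cmod z ^ k)) as [l Hl].
  - intros k. change (Cmod (c k * z ^ k)%C <= Cmod (c k) * Cmod z ^ k).
    rewrite Cmod_mult, Cmod_pow. apply Rle_refl.
  - apply disc_bounded_ex_series; [exact Hc|]. split; [apply Cmod_ge_0|exact Hz].
  - exists l. apply is_pseries_Cpow. exact Hl.
Qed.

Lemma iota_is_pseries (c : nat -> C) (z l : C) :
  @is_pseries C_AbsRing C_NormedModule c z l ->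
  @iota C_CompleteNormedModule
    (fun w => @is_pseries C_AbsRing C_NormedModule c z w) = l.
Proof.
  intros Hl. apply (@iota_unique C_AbsRing C_CompleteNormedModule).
  - intros y Hy. exact (filterlim_locally_unique _ _ _ Hy Hl).
  - exact Hl.
Qed.

Definition CPSeries (c : nat -> C) (z : C) : C :=
  @iota C_CompleteNormedModule
    (fun w => @is_pseries C_AbsRing C_NormedModule c z w).

Lemma CPSeries_correct (c : nat -> C) (z : C) :
  disc_bounded c -> E z ->
  @is_pseries C_AbsRing C_NormedModule c z (CPSeries c z).
Proof.
  intros Hc Hz. destruct (ex_pseries_disc c z Hc Hz) as [l Hl].
  unfold CPSeries. rewrite (iota_is_pseries c z l Hl). exact Hl.
Qed.

(** The derivative of z^k. At k = 0 the truncated predecessor is harmless, the factor [INR k] being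
    0. *)
Definition dpow (z : C) (k : nat) : C := (INR k * z ^ pred k)%C.

Lemma dpow_S (z : C) (k : nat) : dpow z (S k) = (z * dpow z k + z ^ k)%C.
Proof.
  unfold dpow. rewrite S_INR, RtoC_plus. destruct k as [|k]; simpl; ring.
Qed.

Lemma Cmod_dpow_le (z : C) (r : R) (k : nat) : 0 <= r -> Cmod z <= r ->
  r * Cmod (dpow z k) <= INR k * r ^ k.
Proof.
  intros Hr0 Hr. unfold dpow. assert (Hk := pos_INR k).
  rewrite Cmod_mult, Cmod_R, Rabs_pos_eq, Cmod_pow by exact Hk.
  destruct k as [|k]; [simpl; lra|].
  simpl pred. simpl pow at 2.
  assert (Cmod z ^ k <= r ^ k) by (apply pow_incr; split; [apply Cmod_ge_0|exact Hr]).
  assert (0 <= r * INR (S k)) by (apply Rmult_le_pos; assumption). nra.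
Qed.

(** Induction on k: the remainder R_k satisfies R_(k+1) = w R_k + k z^(k-1) (w - z)^2, and k^2 + k
    <= (k + 1)^2. The factor r^2 on the left avoids the exponent k - 2. *)
Lemma Cpow_taylor_le (z w : C) (r : R) (k : nat) :
  Cmod z <= r -> Cmod w <= r ->
  r * r * Cmod (w ^ k - z ^ k - dpow z k * (w - z))
    <= INR k ^ 2 * r ^ k * Cmod (w - z) ^ 2.
Proof.
  intros Hz Hw. assert (Hr : 0 <= r) by (pose proof (Cmod_ge_0 z); lra).
  induction k as [|k IH].
  - simpl. unfold dpow. simpl.
    replace (1 - 1 - 0 * 1 * (w - z))%C with (RtoC 0) by ring.
    rewrite Cmod_0. lra.
  - replace (w ^ S k - z ^ S k - dpow z (S k) * (w - z))%C
      with (w * (w ^ k - z ^ k - dpow z k * (w - z))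
            + dpow z k * ((w - z) * (w - z)))%C
      by (rewrite dpow_S; simpl; ring).
    eapply Rle_trans;
      [apply Rmult_le_compat_l; [nra|apply Cmod_triangle]|].
    rewrite !(Cmod_mult _ (_ * _)%C), !Cmod_mult.
    assert (Hd := Cmod_dpow_le z r k Hr Hz).
    set (e := Cmod (w ^ k - z ^ k - dpow z k * (w - z))) in *.
    assert (He : 0 <= e) by apply Cmod_ge_0.
    set (h := Cmod (w - z)) in *. set (m := Cmod (dpow z k)) in *.
    assert (Hrk : 0 <= r ^ k) by (apply pow_le, Hr).
    assert (Hk := pos_INR k). rewrite S_INR. simpl pow at 2.
    assert (T1 : r * r * (Cmod w * e) <= r * (INR k ^ 2 * r ^ k * h ^ 2)).
    { apply Rle_trans with (r * (r * r * e)); [|apply Rmult_le_compat_l; assumption].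
      assert (0 <= r * r * e) by (apply Rmult_le_pos; nra). nra. }
    assert (T2 : r * r * (m * (h * h)) <= r * (INR k * r ^ k) * (h * h)).
    { replace (r * r * (m * (h * h))) with (r * (r * m) * (h * h)) by ring.
      apply Rmult_le_compat_r; [nra|]. apply Rmult_le_compat_l; assumption. }
    assert (0 <= (INR k + 1) * (r * r ^ k * (h * h))).
    { apply Rmult_le_pos; [lra|]. apply Rmult_le_pos; nra. }
    nra.
Qed.

Lemma is_series_CPSeries (c : nat -> C) (z : C) :
  disc_bounded c -> E z ->
  @is_series C_AbsRing C_NormedModule (fun k => c k * z ^ k)%C (CPSeries c z).
Proof. intros Hc Hz. apply is_pseries_Cpow, CPSeries_correct; assumption. Qed.

(** Termwise differentiation, the remainder being dominated through [Cpow_taylor_le];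
    coefficientwise, passing from f to f + z f' multiplies c_k by k + 1. *)
Lemma CPSeries_euler_step (c : nat -> C) :
  disc_bounded c ->
  euler_step (CPSeries c) (CPSeries (fun k => (INR k + 1)%R * c k)%C).
Proof.
  intros Hc z Hz.
  (* One factor k + 1 serves the derivative series, two serve the quadratic remainder. *)
  assert (Hc1 := disc_bounded_succ_mul c Hc).
  assert (Hc2 := disc_bounded_succ_mul _ Hc1).
  set (r := (1 + Cmod z) / 2). assert (Hz0 := Cmod_ge_0 z). unfold E in Hz.
  assert (Hr : 0 < r < 1) by (unfold r; lra).
  assert (HD : exists D, @is_series C_AbsRing C_NormedModule
                 (fun k => c k * dpow z k)%C D).
  { apply (@ex_series_le C_AbsRing C_CompleteNormedModule
      _ (fun k => / r * (Cmod ((INR k + 1)%R * c k)%C * r ^ k))).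
    - intros k. change (Cmod (c k * dpow z k)%C <=
        / r * (Cmod ((INR k + 1)%R * c k)%C * r ^ k)).
      rewrite !Cmod_mult, Cmod_R.
      assert (Hk := pos_INR k). rewrite Rabs_pos_eq by lra.
      assert (Hd := Cmod_dpow_le z r k ltac:(lra) ltac:(unfold r; lra)).
      assert (Hck := Cmod_ge_0 (c k)).
      apply (Rmult_le_reg_l r); [lra|].
      rewrite <- !Rmult_assoc, Rinv_r, Rmult_1_l by lra.
      assert (0 <= r ^ k) by (apply pow_le; lra). nra.
    - apply (@ex_series_scal R_AbsRing R_NormedModule (/ r)). apply disc_bounded_ex_series; [exact Hc1|lra]. }
  destruct HD as [D HD].
  destruct (disc_bounded_ex_series _ r Hc2 ltac:(lra)) as [B HB].
  exists D. split.
  - assert (HB0 : 0 <= B).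
    { apply Rle_trans with (Cmod 0); [apply Cmod_ge_0|].
      apply is_series_Cmod_le with (u := fun _ => RtoC 0)
        (b := fun k => Cmod ((INR k + 1)%R * ((INR k + 1)%R * c k))%C * r ^ k).
      - apply filterlim_ext with (fun _ => RtoC 0); [|apply filterlim_const].
        intros n. induction n as [|n IH]; [rewrite sum_O; reflexivity|].
        rewrite sum_Sn, <- IH. symmetry. apply Cplus_0_l.
      - exact HB.
      - intros k. rewrite Cmod_0.
        apply Rmult_le_pos; [apply Cmod_ge_0|apply pow_le; lra]. }
    apply cderiv_intro with (B / (r * r)).
    { apply Rdiv_le_0_compat; nra. }
    (* The bound by [eps] turns |w - z|^2 into eps |w - z|; the bound by r - |z| keeps |w| <= r. *)
    intros eps Heps. exists (Rmin eps (r - Cmod z)).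
    split; [apply Rmin_glb_lt; [lra|unfold r; lra]|].
    intros w Hw.
    assert (Hw1 := Rlt_le_trans _ _ _ Hw (Rmin_l _ _)).
    assert (Hw2 := Rlt_le_trans _ _ _ Hw (Rmin_r _ _)).
    assert (Hwr : Cmod w <= r).
    { pose proof (Cmod_triangle z (w - z)) as Ht.
      replace (z + (w - z))%C with w in Ht by ring. lra. }
    assert (HEw : E w) by (unfold E; lra).
    assert (HS := is_series_minus _ _ _ _
      (is_series_minus _ _ _ _ (is_series_CPSeries c w Hc HEw)
         (is_series_CPSeries c z Hc Hz))
      (is_series_scal (w - z)%C _ _ HD)).
    set (h := Cmod (w - z)) in *. assert (Hh : 0 <= h) by apply Cmod_ge_0.
    apply Rle_trans with (h ^ 2 / (r * r) * B).
    2:{ replace (eps * (B / (r * r)) * h) with (eps * h / (r * r) * B) by (field; lra).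
        apply Rmult_le_compat_r; [exact HB0|].
        apply Rmult_le_compat_r; [left; apply Rinv_0_lt_compat; nra|]. nra. }
    apply is_series_Cmod_le with (2 := is_series_scal (h ^ 2 / (r * r)) _ _ HB)
      (u := fun k => (c k * (w ^ k - z ^ k - dpow z k * (w - z)))%C).
    + replace (CPSeries c w - CPSeries c z - D * (w - z))%C
        with (CPSeries c w - CPSeries c z - (w - z) * D)%C by ring.
      eapply is_series_ext; [|exact HS]. intros k.
      change ((c k * w ^ k - c k * z ^ k - (w - z) * (c k * dpow z k))%C
        = (c k * (w ^ k - z ^ k - dpow z k * (w - z)))%C). ring.
    + intros k.
      change (Cmod (c k * (w ^ k - z ^ k - dpow z k * (w - z)))%C <=
        h ^ 2 / (r * r) * (Cmod ((INR k + 1)%R * ((INR k + 1)%R * c k))%C * r ^ k)).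
      assert (Hk := pos_INR k).
      rewrite !(Cmod_mult (RtoC _)), Cmod_R, Rabs_pos_eq, Cmod_mult by lra.
      assert (HT := Cpow_taylor_le z w r k ltac:(unfold r; lra) Hwr).
      fold h in HT.
      set (e := Cmod (w ^ k - z ^ k - dpow z k * (w - z))) in *.
      assert (Hck := Cmod_ge_0 (c k)).
      apply (Rmult_le_reg_l (r * r)); [nra|].
      replace (r * r * (h ^ 2 / (r * r) * ((INR k + 1) * ((INR k + 1) * Cmod (c k)) * r ^ k)))
        with (Cmod (c k) * ((INR k + 1) ^ 2 * r ^ k * h ^ 2)) by (field; lra).
      replace (r * r * (Cmod (c k) * e)) with (Cmod (c k) * (r * r * e)) by ring.
      apply Rmult_le_compat_l; [exact Hck|].
      eapply Rle_trans; [exact HT|].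
      apply Rmult_le_compat_r; [apply pow2_ge_0|].
      apply Rmult_le_compat_r; [apply pow_le; lra|]. nra.
  - assert (HS := is_series_plus _ _ _ _ (is_series_CPSeries c z Hc Hz)
      (is_series_scal z _ _ HD)).
    unfold CPSeries at 1. apply iota_is_pseries, is_pseries_Cpow.
    eapply is_series_ext; [|exact HS]. intros k.
    change ((c k * z ^ k + z * (c k * dpow z k))%C
      = ((INR k + 1)%R * c k * z ^ k)%C).
    rewrite RtoC_plus.
    replace (z * (c k * dpow z k))%C with (c k * (dpow z (S k) - z ^ k))%C
      by (rewrite dpow_S; ring).
    unfold dpow. rewrite S_INR, RtoC_plus. simpl pred. ring.
Qed.

(** Convergence at the real point r bounds all but finitely many terms, by Cauchy's criterion; a
    maximum handles the rest. *)
Lemma is_pseries_disc_bounded (a : nat -> C) :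
  (forall z : C, E z -> exists l, @is_pseries C_AbsRing C_NormedModule a z l) ->
  disc_bounded a.
Proof.
  intros Ha r Hr.
  destruct (Ha (RtoC r)) as [l Hl].
  { unfold E. rewrite Cmod_R, Rabs_pos_eq; lra. }
  apply is_pseries_Cpow in Hl.
  assert (HC := Cauchy_ex_series (K := C_AbsRing) (V := C_CompleteNormedModule)
    _ (ex_intro _ l Hl)).
  destruct (HC (mkposreal 1 Rlt_0_1)) as [N HN].
  assert (Hbig : forall k, (N <= k)%nat -> Cmod (a k) * r ^ k <= 1).
  { intros k Hk. specialize (HN k k Hk Hk). rewrite sum_n_n in HN.
    change (Cmod (a k * RtoC r ^ k)%C < 1) in HN.
    rewrite Cmod_mult, Cmod_pow, Cmod_R, Rabs_pos_eq in HN by lra.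
    lra. }
  assert (Hsmall : forall n, exists M, forall k, (k < n)%nat -> Cmod (a k) * r ^ k <= M).
  { induction n as [|n [M HM]]; [exists 0; lia|].
    exists (Rmax M (Cmod (a n) * r ^ n)). intros k Hk.
    destruct (Nat.eq_dec k n) as [->|Hne]; [apply Rmax_r|].
    eapply Rle_trans; [apply HM; lia|apply Rmax_l]. }
  destruct (Hsmall N) as [M HM]. exists (Rmax 1 M). intros k.
  destruct (Nat.lt_ge_cases k N) as [Hk|Hk].
  - eapply Rle_trans; [apply HM, Hk|apply Rmax_r].
  - eapply Rle_trans; [apply Hbig, Hk|apply Rmax_l].
Qed.

(** Dividing by r fails at r = 0; instead r is raised to r' >= 1/2, and dividing by r' costs at most
    a factor 2. *)
Lemma disc_bounded_shift (a : nat -> C) :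
  disc_bounded a -> disc_bounded (fun k => a (S k)).
Proof.
  intros Ha r Hr. set (r' := (1 + r) / 2).
  destruct (Ha r') as [M HM]; [unfold r'; lra|].
  exists (2 * M). intros k. specialize (HM (S k)). simpl in HM.
  assert (Hk : r ^ k <= r' ^ k) by (apply pow_incr; unfold r'; lra).
  assert (Hk0 : 0 <= r ^ k) by (apply pow_le; lra).
  assert (Hck := Cmod_ge_0 (a (S k))).
  apply Rle_trans with (Cmod (a (S k)) * r' ^ k); [nra|].
  assert (0 <= Cmod (a (S k)) * r' ^ k) by (apply Rmult_le_pos; lra).
  assert (/ 2 <= r') by (unfold r'; lra). nra.
Qed.

(** * The operators L_n *)

(** Since [sigma] may have either sign, the exponent is bounded through sigma ln(2/(k+1)) <= |sigma|
    (ln 2 + ln(k+1)). *)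
Lemma Rpower_le_pow (sigma : R) :
  exists N : nat, forall k : nat,
    Rpower (2 / (INR k + 1)) sigma <= (2 * (INR k + 1)) ^ N.
Proof.
  destruct (INR_unbounded (Rabs sigma)) as [N HN]. exists N. intros k.
  assert (Hk := pos_INR k).
  rewrite <- Rpower_pow by lra. unfold Rpower.
  assert (Hm : sigma * ln (2 / (INR k + 1)) <= INR N * ln (2 * (INR k + 1))).
  { unfold Rdiv. rewrite !ln_mult, ln_Rinv by (try apply Rinv_0_lt_compat; lra).
    assert (H2 : 0 <= ln 2) by (rewrite <- ln_1; apply ln_le; lra).
    assert (H3 : 0 <= ln (INR k + 1)) by (rewrite <- ln_1; apply ln_le; lra).
    apply Rabs_lt_between in HN. nra. }
  destruct Hm as [Hm|Hm]; [left; apply exp_increasing, Hm|right; f_equal; exact Hm].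
Qed.

Lemma L_mult_1 (n : nat) (sigma : R) : L_mult n sigma 1 = 1.
Proof.
  unfold L_mult. simpl INR. rewrite pow1.
  replace (2 / (1 + 1)) with 1 by field. unfold Rpower.
  rewrite ln_1, Rmult_0_r, exp_0. ring.
Qed.

Lemma L_mult_bound (n : nat) (sigma : R) :
  exists (N : nat) (B : R), 0 <= B /\
    forall k : nat, Rabs (L_mult n sigma (S k)) <= B * (INR k + 1) ^ N.
Proof.
  destruct (Rpower_le_pow sigma) as [N HN].
  exists (n + N)%nat, (2 ^ N * 2 ^ N). split.
  { apply Rmult_le_pos; apply pow_le; lra. }
  intros k. unfold L_mult. specialize (HN (S k)). rewrite S_INR in *.
  assert (Hk := pos_INR k).
  assert (Hn : 0 <= (INR k + 1) ^ n) by (apply pow_le; lra).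
  assert (HR : 0 < Rpower (2 / (INR k + 1 + 1)) sigma) by apply exp_pos.
  rewrite Rabs_pos_eq by (apply Rmult_le_pos; lra).
  assert (HN2 : (2 * (INR k + 1 + 1)) ^ N <= (2 * (2 * (INR k + 1))) ^ N)
    by (apply pow_incr; lra).
  rewrite (Rpow_mult_distr 2), (Rpow_mult_distr 2) in HN2.
  rewrite (Rpow_mult_distr 2 (INR k + 1)) in HN2.
  rewrite (Rpow_mult_distr 2) in HN. rewrite pow_add.
  apply Rle_trans with ((INR k + 1) ^ n * (2 ^ N * (2 ^ N * (INR k + 1) ^ N))).
  - apply Rmult_le_compat_l; lra.
  - right. ring.
Qed.

(** [H n] has coefficients [L_mult n sigma (S k) * a (S k)]; raising n by one multiplies the k-th
    one by k + 1, which is what [euler_step] does. A single family for all n links consecutive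
    indices. *)
Lemma L_factor (sigma : R) (f : C -> C) :
  class_A f -> exists H : nat -> C -> C, forall n : nat,
    H n (RtoC 0) = RtoC 1 /\ euler_step (H n) (H (S n)) /\
    forall z : C, E z -> L n sigma f z = (z * H n z)%C.
Proof.
  intros [_ Hex].
  assert (Hcoef : expansion f (coef f)).
  { unfold coef. apply epsilon_spec. exact Hex. }
  set (a := coef f) in *. destruct Hcoef as [Ha0 [Ha1 Ha]].
  assert (Hda : disc_bounded (fun k => a (S k))).
  { apply disc_bounded_shift, is_pseries_disc_bounded.
    intros z Hz. exists (f z). apply Ha, Hz. }
  set (c := fun n k => (L_mult n sigma (S k) * a (S k))%C).
  assert (Hc : forall n, disc_bounded (c n)).
  { intros n. destruct (L_mult_bound n sigma) as [N [B [HB HN]]].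
    apply (disc_bounded_le _ _ B HB) with (2 := disc_bounded_pow_mul _ N Hda).
    intros k. unfold c. rewrite !Cmod_mult, !Cmod_R.
    assert (Hk := pos_INR k).
    rewrite (Rabs_pos_eq ((INR k + 1) ^ N)) by (apply pow_le; lra).
    rewrite <- Rmult_assoc. apply Rmult_le_compat_r; [apply Cmod_ge_0|apply HN]. }
  exists (fun n => CPSeries (c n)). intros n. split; [|split].
  - apply iota_is_pseries.
    replace (RtoC 1) with (c n 0%nat)
      by (unfold c; rewrite L_mult_1, Ha1; ring).
    apply (@is_pseries_0 C_AbsRing C_NormedModule).
  - assert (HS := CPSeries_euler_step _ (Hc n)).
    intros z Hz. destruct (HS z Hz) as [D [HD HDz]]. exists D.
    split; [exact HD|]. rewrite <- HDz.
    symmetry. apply iota_is_pseries.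
    assert (Hcs : forall k, c (S n) k = ((INR k + 1)%R * c n k)%C).
    { intros k. unfold c, L_mult. rewrite S_INR. simpl pow.
      rewrite !RtoC_mult. ring. }
    exact (is_pseries_ext _ _ _ _ Hcs (CPSeries_correct _ _ (Hc (S n)) Hz)).
  - intros z Hz. unfold L. apply iota_is_pseries.
    assert (HP := is_pseries_incr_1 _ _ _ (CPSeries_correct _ _ (Hc n) Hz)).
    eapply is_pseries_ext; [|exact HP].
    (* [L_mult 0 sigma 0] is nonzero since 0^0 = 1, so the constant term has to be removed by
       [a 0 = 0]. *)
    intros [|k]; [|reflexivity]. fold a. rewrite Ha0. symmetry. apply Cmult_0_r.
Qed.

(** * Quotient conditions after cancelling the factor z *)

Lemma sim_iff (delta : R) : 0 <= delta -> delta <> 1 ->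
  exists e : R, (e = 1 \/ e = -1) /\
    forall X : R, sim X delta <-> e * delta < e * X.
Proof.
  intros Hd Hd1. unfold sim. destruct (Rtotal_order delta 1) as [H|[H|H]].
  - exists 1. split; [left; reflexivity|]. intros X. split; [intros [|]; lra|lra].
  - contradiction.
  - exists (-1). split; [right; reflexivity|]. intros X. split; [intros [|]; lra|lra].
Qed.

(** The factor x cancels on a punctured neighbourhood, so the removable singularity at the origin
    needs no separate treatment of the value. *)
Lemma quotient_value_factor (F G K H : C -> C) (z k h : C) :
  (forall x : C, E x -> F x = (x * K x)%C) ->
  (forall x : C, E x -> G x = (x * H x)%C) ->
  cderiv K z k -> cderiv H z h -> H z <> RtoC 0 -> E z ->
  quotient_value F G z (K z / H z)%C.
Proof.
  intros HF HG Hk Hh Hn Hz. unfold E in *.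
  destruct (ccont_neq_0 _ _ (cderiv_ccont _ _ _ Hh) Hn) as [d1 [Hd1 Hx1]].
  (* At z = 0 the puncture itself keeps x away from 0; elsewhere the radius |z| does. *)
  assert (Hx2 : exists d2, 0 < d2 /\ forall x, x <> z -> Cmod (x - z) < d2 ->
            x <> RtoC 0).
  { destruct (Req_dec (Cmod z) 0) as [Hz0|Hz0].
    - apply Cmod_eq_0 in Hz0. exists 1. split; [lra|]. intros x Hx _.
      rewrite <- Hz0. exact Hx.
    - exists (Cmod z). split; [pose proof (Cmod_ge_0 z); lra|].
      intros x _ Hx ->. pose proof (Cmod_le_plus_minus z 0) as Ht.
      rewrite Cmod_0 in Ht. lra. }
  destruct Hx2 as [d2 [Hd2 Hx2]].
  apply (quotient_value_intro _ _ (fun x => K x / H x)%C z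
           (Rmin (1 - Cmod z) (Rmin d1 d2))).
  - repeat apply Rmin_glb_lt; lra.
  - intros x Hne Hx.
    assert (Ha := Rlt_le_trans _ _ _ Hx (Rmin_l _ _)).
    assert (Hb := Rlt_le_trans _ _ _ Hx (Rmin_r _ _)).
    specialize (Hx1 x (Rlt_le_trans _ _ _ Hb (Rmin_l _ _))).
    specialize (Hx2 x Hne (Rlt_le_trans _ _ _ Hb (Rmin_r _ _))).
    pose proof (Cmod_triangle z (x - z)) as Ht.
    replace (z + (x - z))%C with x in Ht by ring.
    rewrite HF, HG by lra. field. split; [|exact Hx2].
    apply Cmod_gt_0. pose proof (Cmod_ge_0 (H z)). lra.
  - exact (cderiv_ccont _ _ _ (cderiv_div _ _ _ _ _ Hk Hh Hn)).
Qed.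

(** Once [H] has no zeros, the limit in [quotient_value] exists everywhere on E and equals the
    pointwise quotient, so the existential disappears. *)
Lemma Re_quotient_sim_factor (F G K K' H H' : C -> C) (delta : R) :
  euler_step K K' -> euler_step H H' ->
  (forall x : C, E x -> F x = (x * K x)%C) ->
  (forall x : C, E x -> G x = (x * H x)%C) ->
  (forall z : C, E z -> H z <> RtoC 0) ->
  (Re_quotient_sim F G delta <-> forall z : C, E z -> sim (Re (K z / H z)%C) delta).
Proof.
  intros HK HH HF HG Hn.
  assert (Hq : forall z, E z -> quotient_value F G z (K z / H z)%C).
  { intros z Hz. destruct (HK z Hz) as [k [Hk _]]. destruct (HH z Hz) as [h [Hh _]].
    apply (quotient_value_factor F G K H z k h); auto. }
  split; intros Hs z Hz.
  - destruct (Hs z Hz) as [w [Hw Hsim]].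
    rewrite <- (quotient_value_unique _ _ _ _ _ Hw (Hq z Hz)). exact Hsim.
  - exists (K z / H z)%C. auto.
Qed.

(** * Passage from index [S n] to index [n] *)

Theorem theorem1 : forall (n : nat) (sigma beta gamma : R),
  0 <= beta -> beta <> 1 -> 0 <= gamma < 1 ->
  forall f : C -> C,
    class_K (S n) sigma beta gamma f -> class_K n sigma beta gamma f.
Proof.
  intros n sigma beta gamma Hb0 Hb1 Hg f [HfA [g [[HgA Hgq] Hfq]]].
  destruct (L_factor sigma f HfA) as [K HK].
  destruct (L_factor sigma g HgA) as [H HH].
  destruct (HH n) as [H00 [HS0 HL0]].
  destruct (HH (S n)) as [H10 [HS1 HL1]].
  destruct (HH (S (S n))) as [_ [HS2 HL2]].
  destruct (HK (S n)) as [K10 [KS1 KL1]].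
  destruct (HK (S (S n))) as [_ [KS2 KL2]].
  assert (HE0 : E (RtoC 0)) by (unfold E; rewrite Cmod_0; lra).
  assert (Hsim : forall X, sim X gamma <-> gamma < X)
    by (intros X; unfold sim; split; [intros [|]; lra|lra]).
  (* This must precede [Re_quotient_sim_factor], which assumes no zeros. Where [H (S n)] is nonzero
     the limit is the plain quotient, with real part above gamma >= 0; [euler_step_neq_0] asks for
     no more away from the origin. *)
  assert (Hn1 : forall z, E z -> H (S n) z <> RtoC 0).
  { apply (euler_step_neq_0 _ _ HS1); [rewrite H10; exact C1_nz|].
    intros z Hz Hnz.
    destruct (HS2 z Hz) as [k [Hk _]]. destruct (HS1 z Hz) as [h [Hh _]].
    destruct (Hgq z Hz) as [w [Hw Hsw]]. apply Hsim in Hsw.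
    rewrite <- (quotient_value_unique _ _ _ _ _ Hw
      (quotient_value_factor _ _ _ _ z k h HL2 HL1 Hk Hh Hnz Hz)). lra. }
  rewrite (Re_quotient_sim_factor _ _ _ _ _ _ _ HS2 HS1 HL2 HL1 Hn1) in Hgq.
  rewrite (Re_quotient_sim_factor _ _ _ _ _ _ _ KS2 HS1 KL2 HL1 Hn1) in Hfq.
  assert (Hdisc : forall z, E z ->
    gamma * Cmod (H n z / H (S n) z) ^ 2 < Re (H n z / H (S n) z)%C).
  { apply (ratio_disc _ _ (H (S (S n)))); try assumption.
    intros z Hz. apply Hsim, Hgq, Hz. }
  assert (Hn0 : forall z, E z -> H n z <> RtoC 0).
  { intros z Hz Hz0. specialize (Hdisc z Hz). rewrite Hz0 in Hdisc.
    replace (0 / H (S n) z)%C with (RtoC 0) in Hdisc by (field; apply Hn1, Hz).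
    rewrite Cmod_0 in Hdisc. simpl in Hdisc. lra. }
  split; [exact HfA|]. exists g. split; [split; [exact HgA|]|].
  - apply (Re_quotient_sim_factor _ _ _ _ _ _ _ HS1 HS0 HL1 HL0 Hn0).
    intros z Hz. apply Hsim. specialize (Hdisc z Hz).
    specialize (Hn0 z Hz). specialize (Hn1 z Hz).
    set (s := (H n z / H (S n) z)%C) in *.
    assert (Hs : s <> RtoC 0).
    { intros Hs. rewrite Hs, Cmod_0 in Hdisc. simpl in Hdisc. lra. }
    replace (H (S n) z / H n z)%C with (/ s)%C by (unfold s; field; split; assumption).
    apply Cmod_gt_0 in Hs. rewrite Cmod2_alt in Hdisc.
    assert (Hs2 : 0 < Cmod s ^ 2) by (apply pow_lt, Hs). rewrite Cmod2_alt in Hs2.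
    change (Re (/ s)%C) with (Re s / (Re s ^ 2 + Im s ^ 2)).
    apply Rlt_div_r; assumption.
  - apply (Re_quotient_sim_factor _ _ _ _ _ _ _ KS1 HS0 KL1 HL0 Hn0).
    (* The sign [e] turns both senses of [sim] into one strict lower bound, for e K in place of
       K. *)
    destruct (sim_iff beta Hb0 Hb1) as [e [He Hbeta]].
    assert (Hscal : forall a b : C, Re ((e * a) / b)%C = e * Re (a / b)%C).
    { intros a b. rewrite <- re_scal_l. unfold Cdiv. rewrite Cmult_assoc. reflexivity. }
    assert (Hkey : forall z, E z -> e * beta < Re ((e * K (S n) z) / H n z)%C).
    { apply (ratio_half_plane (fun z => e * K (S n) z)%C
               (fun z => e * K (S (S n)) z)%C (H n) (H (S n))).
      - intros z Hz. destruct (KS1 z Hz) as [D [HD HDz]]. exists (e * D)%C.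
        split; [apply cderiv_scal, HD|]. rewrite HDz. ring.
      - exact HS0.
      - exact Hn0.
      - exact Hn1.
      - intros z Hz. specialize (Hdisc z Hz).
        assert (0 <= gamma * Cmod (H n z / H (S n) z) ^ 2)
          by (apply Rmult_le_pos; [lra|apply pow2_ge_0]). lra.
      (* Both quotients equal 1 at the origin, so this is the hypothesis at z = 0. *)
      - rewrite Hscal, K10, H00.
        destruct (HS0 _ HE0) as [d [_ Hd]]. specialize (Hfq _ HE0).
        apply Hbeta in Hfq.
        destruct (HK (S (S n))) as [K20 _]. rewrite K20, H10 in Hfq. exact Hfq.
      - intros z Hz. rewrite Hscal. apply Hbeta, Hfq, Hz. }
    intros z Hz. apply Hbeta. rewrite <- Hscal. apply Hkey, Hz.
Qed.
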